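(* For $n\in\mathbb{N}$ write $n=2^j m$ with $j\in\mathbb{N}\cup\{0\}$ and $m$ odd. Then $$\frac1n\sum_{k=1}^n c_n(k^2-1)=\begin{cases} c_j, & \text{if } j\in\{0,2,3\} \text{ and } m \text{ is squarefree},\\ 0,&\text{otherwise},\end{cases}$$ where $c_0=c_2=1$ and $c_3=2$ (in particular the value is nonzero in the first case).
   Context: For $n\in\mathbb{N}$ and $k\in\mathbb{Z}$, $c_n(k)=\sum_{1\le j\le n,\ \gcd(j,n)=1}\exp(2\pi i jk/n)$ is the Ramanujan sum. The constants $c_0,c_2,c_3$ are just numbers, not Ramanujan sums. *)

(* Defs.v *)
From HB Require Import structures.
From mathcomp Require Import all_boot all_order all_algebra.
From mathcomp Require Import all_classical all_reals all_analysis.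
From mathcomp Require Export complex.
Set Implicit Arguments.
Unset Strict Implicit.
Unset Printing Implicit Defensive.
Import Order.TTheory GRing.Theory Num.Theory.

Local Open Scope ring_scope.
Local Open Scope complex_scope.

Definition cexp (R : realType) (z : R[i]) : R[i] :=
  let: x +i* y := z in (expR x * cos y) +i* (expR x * sin y).

Definition ramanujan_sum (R : realType) (n : nat) (k : int) : R[i] :=
  \sum_(1 <= j < n.+1 | coprime j n)
    cexp ((2 * pi * j%:R * k%:~R / n%:R : R) *i).

Definition squarefree (m : nat) : Prop :=
  forall d : nat, (d ^ 2 %| m)%N -> d = 1%N.

(* Only the values at 0, 2 and 3 are meaningful. *)
Definition const_c (j : nat) : nat :=
  (match j with 0 => 1 | 2 => 1 | 3 => 2 | _ => 0 end)%N.

(* Main.v *)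
Require Import Defs.
From mathcomp Require Import all_boot all_order all_algebra.
From mathcomp Require Import all_classical all_reals all_analysis.
From mathcomp Require Import zify ring lra.
Set Implicit Arguments.
Unset Strict Implicit.
Unset Printing Implicit Defensive.
Import Order.TTheory GRing.Theory Num.Theory.
Local Open Scope ring_scope.
Local Open Scope complex_scope.

(** For an integer polynomial f let S(n) be the average of c_n(f(k)) over k
    modulo n.  Grouping the n-th roots of unity by their order gives
    sum_{d | n} c_d(a) = n if n divides a and 0 otherwise, hence
    sum_{d | n} S(d) = N(n), the number of roots of f modulo n.  By the Chinese
    remainder theorem N is multiplicative, so S is multiplicative too, with
    S(p^e) = N(p^e) - N(p^(e-1)).  For f = X^2 - 1 the factorisation
    (k - 1) (k + 1) gives N(p^e) = 2 for odd p and e > 0, and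
    N(2^e) = 1, 1, 2, 4, 4, ... for e = 0, 1, 2, ... *)

Definition multiplicative (R : pzSemiRingType) (f : nat -> R) : Prop :=
  f 1%N = 1 /\
  forall a b, (0 < a)%N -> (0 < b)%N -> coprime a b ->
    f (a * b)%N = f a * f b.

Definition divisor_sum (V : nmodType) (f : nat -> V) (n : nat) : V :=
  \sum_(d <- divisors n) f d.

Lemma eq_multiplicative (R : pzSemiRingType) (f g : nat -> R) :
    (forall n, (0 < n)%N -> f n = g n) ->
  multiplicative f -> multiplicative g.
Proof.
move=> fg [f1 fM]; split=> [|a b a_gt0 b_gt0 co]; first by rewrite -fg.
by rewrite -!fg ?muln_gt0 ?a_gt0 // fM.
Qed.

Lemma multiplicative_natr (R : pzSemiRingType) (f : nat -> nat) :
  multiplicative f -> multiplicative (fun n => (f n)%:R : R).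
Proof.
by case=> f1 fM; split=> [|a b *]; [rewrite f1 | rewrite fM // natrM].
Qed.

Lemma multiplicative_prod_primes (R : pzSemiRingType) (f : nat -> R) (n : nat) :
  multiplicative f -> (0 < n)%N ->
  f n = \prod_(p <- primes n) f (p ^ logn p n)%N.
Proof.
move=> [f1 fM] n_gt0.
have primes_prime : all prime (primes n).
  by apply/allP => p; rewrite mem_primes => /andP[].
rewrite {1}[n]prod_prime_decomp // prime_decompE big_map /=.
elim: (primes n) (primes_uniq n) primes_prime => [|p s IHs] /=.
  by rewrite !big_nil.
move=> /andP[p_notin s_uniq] /andP[p_pr s_pr]; rewrite !big_cons -IHs // fM //.
  by rewrite prodn_gt0.
rewrite coprimeXl // big_seq.
elim/big_rec: _ => [|q x q_in co]; first exact: coprimen1.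
rewrite coprimeMr co andbT coprimeXr // prime_coprime // dvdn_prime2 //.
  by apply: contraNneq p_notin => ->.
exact: allP q_in.
Qed.

Lemma divisorsM_perm (a b : nat) : (0 < a)%N -> (0 < b)%N -> coprime a b ->
  perm_eq (divisors (a * b)) [seq (x * y)%N | x <- divisors a, y <- divisors b].
Proof.
move=> a_gt0 b_gt0 co; have ab_gt0 : (0 < a * b)%N by rewrite muln_gt0 a_gt0.
have gcd_left x y : (x %| a)%N -> (y %| b)%N -> gcdn (x * y) a = x.
  move=> xa yb; rewrite gcdnC Gauss_gcdl; first exact/gcdn_idPr.
  exact: coprime_dvdr yb co.
have gcd_right x y : (x %| a)%N -> (y %| b)%N -> gcdn (x * y) b = y.
  move=> xa yb; rewrite gcdnC Gauss_gcdr; first exact/gcdn_idPr.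
  by rewrite coprime_sym; apply: coprime_dvdl xa co.
apply: uniq_perm; rewrite ?divisors_uniq //.
  apply: allpairs_uniq; rewrite ?divisors_uniq //.
  move=> _ _ /allpairsP[[x y] [/= xa yb ->]] /allpairsP[[u v] [/= ua vb ->]] /=.
  rewrite -!dvdn_divisors // in xa yb ua vb => xy_uv.
  congr pair; first by rewrite -(gcd_left x y) // xy_uv gcd_left.
  by rewrite -(gcd_right x y) // xy_uv gcd_right.
move=> d; rewrite -dvdn_divisors //; apply/idP/allpairsP => [dab|[[x y] /=]].
  exists (gcdn d a, gcdn d b) => /=; rewrite -!dvdn_divisors // !dvdn_gcdr.
  split=> //; apply/eqP; rewrite eqn_dvd Gauss_dvd ?dvdn_gcdl; last first.
    by apply: coprime_dvdl (dvdn_gcdr d a) (coprime_dvdr (dvdn_gcdr d b) co).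
  rewrite muln_gcdr !muln_gcdl !dvdn_gcd dab.
  by rewrite !(dvdn_mulr _ (dvdnn d), dvdn_mull _ (dvdnn d)).
by rewrite -!dvdn_divisors // => -[xa yb ->]; apply: dvdn_mul.
Qed.

Lemma divisor_sumM (V : nmodType) (f : nat -> V) (a b : nat) :
    (0 < a)%N -> (0 < b)%N -> coprime a b ->
  divisor_sum f (a * b) =
  \sum_(x <- divisors a) \sum_(y <- divisors b) f (x * y)%N.
Proof.
move=> a_gt0 b_gt0 co.
rewrite /divisor_sum (perm_big _ (divisorsM_perm a_gt0 b_gt0 co)).
by rewrite big_allpairs_dep.
Qed.

Lemma divisors_pfactor_perm (p e : nat) : prime p ->
  perm_eq (divisors (p ^ e)) [seq (p ^ i)%N | i <- iota 0 e.+1].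
Proof.
move=> p_pr; have p_gt1 := prime_gt1 p_pr.
apply: uniq_perm; rewrite ?divisors_uniq //.
  by rewrite map_inj_uniq ?iota_uniq //; apply: expnI.
move=> d; rewrite -dvdn_divisors ?expn_gt0 ?prime_gt0 //.
by apply/(dvdn_pfactor d e p_pr)/mapP => -[i i_le ->]; exists i;
  rewrite // mem_iota in i_le *.
Qed.

Lemma divisor_sum_pfactor (V : nmodType) (f : nat -> V) (p e : nat) : prime p ->
  divisor_sum f (p ^ e.+1) = divisor_sum f (p ^ e) + f (p ^ e.+1)%N.
Proof.
move=> p_pr; rewrite /divisor_sum !(perm_big _ (divisors_pfactor_perm _ p_pr)).
by rewrite !big_map -[e.+2]addn1 iotaD big_cat big_seq1.
Qed.

(* By induction f (x * y) = f x * f y for all pairs of divisors x of a and y of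
   b other than (a, b); cancelling these terms leaves the pair (a, b). *)
Lemma multiplicative_of_divisor_sum (R : pzRingType) (f : nat -> R) :
  multiplicative (divisor_sum f) -> multiplicative f.
Proof.
move=> [sum1 sumM]; split=> [|a b].
  by rewrite -sum1 /divisor_sum big_seq1.
have [n] := ubnP (a * b); elim: n a b => // n IHn a b ab_le a_gt0 b_gt0 co.
pose pairs := [seq (x, y) | x <- divisors a, y <- divisors b].
pose proper := [seq d <- pairs | d != (a, b)].
have split_top (F : nat -> nat -> R) :
    \sum_(x <- divisors a) \sum_(y <- divisors b) F x y =
    F a b + \sum_(d <- proper) F d.1 d.2.
  transitivity (\sum_(d <- pairs) F d.1 d.2); first by rewrite big_allpairs_dep.
  rewrite (bigD1_seq (a, b)) ?big_filter //=.
    by rewrite allpairs_f ?divisors_id.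
  by rewrite allpairs_uniq ?divisors_uniq // => -[? ?] [].
have := sumM a b a_gt0 b_gt0 co.
rewrite divisor_sumM // big_distrlr /= !split_top.
suff -> : \sum_(d <- proper) f (d.1 * d.2)%N = \sum_(d <- proper) f d.1 * f d.2.
  exact: addIr.
apply: eq_big_seq => d; rewrite mem_filter.
case/andP=> + /allpairsP[[x y] [/= + + d_xy]].
rewrite d_xy -!dvdn_divisors // => xy_neq xa yb /=.
have x_le := dvdn_leq a_gt0 xa; have y_le := dvdn_leq b_gt0 yb.
apply: IHn; last exact: coprime_dvdl xa (coprime_dvdr yb co).
- by rewrite xpair_eqE negb_and in xy_neq; nia.
- exact: dvdn_gt0 xa.
- exact: dvdn_gt0 yb.
Qed.

Definition num_roots_mod (f : {poly int}) (n : nat) : nat :=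
  count (fun k : nat => (n %| f.[k%:Z])%Z) (iota 0 n).

Lemma dvdz_horner_sub (f : {poly int}) (x y : int) : (x - y %| f.[x] - f.[y])%Z.
Proof.
have /factor_theorem[q fE] : root (f - f.[y]%:P) y.
  by rewrite rootE !hornerE subrr.
have := congr1 (horner^~ x) fE; rewrite !hornerE => ->.
exact: dvdz_mull.
Qed.

Lemma dvdz_horner_mod (f : {poly int}) (d x y : int) :
  (x = y %[mod d])%Z -> (d %| f.[x])%Z = (d %| f.[y])%Z.
Proof.
move/eqP; rewrite eqz_mod_dvd => d_xy.
rewrite -[f.[x]](subrK f.[y]) rpredDl //.
exact: dvdz_trans d_xy (dvdz_horner_sub f x y).
Qed.

Lemma dvdz_horner_modn (f : {poly int}) (d x y : nat) :
  x = y %[mod d] -> (d %| f.[x%:Z])%Z = (d %| f.[y%:Z])%Z.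
Proof.
by move=> xy_mod; apply: dvdz_horner_mod; rewrite !modz_nat xy_mod.
Qed.

Lemma multiplicative_num_roots_mod (f : {poly int}) :
  multiplicative (num_roots_mod f).
Proof.
split=> [|a b a_gt0 b_gt0 co]; first by rewrite /num_roots_mod /= dvd1z.
have ab_gt0 : (0 < a * b)%N by rewrite muln_gt0 a_gt0.
pose crt x y := (chinese a b x y %% (a * b))%N.
have crt_left x y : crt x y = x %[mod a].
  by rewrite /crt modn_dvdm ?dvdn_mulr // chinese_modl.
have crt_right x y : crt x y = y %[mod b].
  by rewrite /crt modn_dvdm ?dvdn_mull // chinese_modr.
pose roots (n : nat) := [seq k : nat <- iota 0 n | (n %| f.[k%:Z])%Z].
have mem_roots (n k : nat) : (k \in roots n) = (n %| f.[k%:Z])%Z && (k < n)%N.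
  by rewrite mem_filter mem_iota.
rewrite /num_roots_mod -!size_filter -[RHS](size_allpairs crt).
apply/perm_size/uniq_perm; first by rewrite filter_uniq ?iota_uniq.
  apply: allpairs_uniq; rewrite ?filter_uniq ?iota_uniq //.
  move=> _ _ /allpairsP[[x y] [/= + + ->]] /allpairsP[[u v] [/= + + ->]] /=.
  rewrite !mem_roots => /andP[_ x_lt] /andP[_ y_lt] /andP[_ u_lt] /andP[_ v_lt].
  move=> crt_eq; have := crt_left x y; have := crt_right x y.
  by rewrite crt_eq crt_left crt_right !modn_small // => -> ->.
move=> k; rewrite mem_roots PoszM Gauss_dvdz //.
apply/idP/allpairsP => [/andP[/andP[ka kb] k_lt]|[[x y] /= [+ + ->]]].
  exists (k %% a, k %% b)%N; rewrite /= !mem_roots !ltn_pmod // !andbT.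
  rewrite (dvdz_horner_modn _ (modn_mod k a)) ka.
  rewrite (dvdz_horner_modn _ (modn_mod k b)) kb.
  by split=> //; rewrite /crt -chinese_mod // modn_small.
rewrite !mem_roots ltn_pmod // => /andP[xa _] /andP[yb _].
rewrite (dvdz_horner_modn _ (crt_left x y)) xa.
by rewrite (dvdz_horner_modn _ (crt_right x y)) yb.
Qed.

Local Notation sqr_sub1 := ('X^2 - 1 : {poly int}).

Section SquareRootsOfOne.
Local Open Scope nat_scope.

Lemma count_iota_eq_size (P : pred nat) (n : nat) (s : seq nat) : uniq s ->
  (forall k, (k < n) && P k = (k \in s)) -> count P (iota 0 n) = size s.
Proof.
move=> s_uniq memsE; rewrite -size_filter; apply/perm_size/uniq_perm => // [|k].
  by rewrite filter_uniq ?iota_uniq.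
by rewrite mem_filter mem_iota andbC memsE.
Qed.

Lemma pfactor_dvdnM (p e a b : nat) : prime p -> ~~ (p %| gcdn a b) ->
  (p ^ e %| a * b) = (p ^ e %| a) || (p ^ e %| b).
Proof.
case: e => [|e] p_pr; first by rewrite !dvd1n.
have not_dvd_pow x : ~~ (p %| x) -> (p ^ e.+1 %| x) = false.
  by move=> px; apply: contraNF px; apply: dvdn_trans; rewrite expnS dvdn_mulr.
rewrite dvdn_gcd negb_and => /orP[pa|pb].
  by rewrite Gauss_dvdr ?(not_dvd_pow a) // coprime_pexpl // prime_coprime.
by rewrite Gauss_dvdl ?(not_dvd_pow b) ?orbF // coprime_pexpl // prime_coprime.
Qed.

Lemma dvdz_sqr_sub1 (n k : nat) :
  (n %| sqr_sub1.[k%:Z])%Z = (k ^ 2 == 1 %[mod n]).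
Proof. by rewrite !hornerE -eqz_mod_dvd -rmorphXn /= !modz_nat. Qed.

Lemma num_roots_mod_sqr_sub1E (n : nat) :
  num_roots_mod sqr_sub1 n = count (fun k => k ^ 2 == 1 %[mod n]) (iota 0 n).
Proof. by apply: eq_count => k; rewrite dvdz_sqr_sub1. Qed.

Lemma sqr_eq1_mod (n k : nat) : 0 < k ->
  (k ^ 2 == 1 %[mod n]) = (n %| (k - 1) * (k + 1)).
Proof.
move=> k_gt0; rewrite eqn_mod_dvd ?expn_gt0 ?k_gt0 //.
by rewrite -{2}(exp1n 2) subn_sqr.
Qed.

Lemma num_roots_mod_sqr_sub1_odd_pfactor (p e : nat) : prime p -> odd p ->
  num_roots_mod sqr_sub1 (p ^ e.+1) = 2.
Proof.
move=> p_pr p_odd; have p_gt2 := odd_prime_gt2 p_odd p_pr.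
set q := p ^ e.+1.
have q_gt2 : 2 < q.
  by rewrite (leq_trans p_gt2) // -{1}(expn1 p) leq_pexp2l; lia.
rewrite num_roots_mod_sqr_sub1E.
apply: (@count_iota_eq_size _ _ [:: 1; q - 1]) => [|k] /=; rewrite !inE.
  lia.
have [->|k_gt0] := posnP k; first by rewrite exp0n // mod0n modn_small; lia.
have [k_lt|] := ltnP k q; last lia.
have p_ndvd_gcd : ~~ (p %| gcdn (k - 1) (k + 1)).
  rewrite dvdn_gcd; apply/negP => /andP[p_pred p_succ].
  have : p %| (k + 1) - (k - 1) by rewrite dvdn_sub.
  by move/dvdn_leq; lia.
rewrite sqr_eq1_mod // pfactor_dvdnM //.
apply/orP/orP => [[/dvdn_leq q_le|/dvdn_leq q_le]|[/eqP->|/eqP->]].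
- by left; lia.
- by right; lia.
- by left; rewrite dvdn0.
- by right; rewrite subnK ?dvdnn; lia.
Qed.

(* For k = 2 l + 1, the condition 2^(e+3) | k^2 - 1 says 2^(e+1) | l (l + 1). *)
Lemma num_roots_mod_sqr_sub1_pow2 (e : nat) :
  num_roots_mod sqr_sub1 (2 ^ e.+3) = 4.
Proof.
set q := 2 ^ e.+1; have -> : 2 ^ e.+3 = 4 * q by rewrite /q !expnS; lia.
have q_even : 2 %| q by rewrite /q expnS dvdn_mulr.
have q_gt1 : 1 < q by rewrite dvdn_leq // expn_gt0.
rewrite num_roots_mod_sqr_sub1E.
apply: (@count_iota_eq_size _ _ [:: 1; 2 * q - 1; 2 * q + 1; 4 * q - 1])
  => [|k] /=; rewrite !inE; first lia.
have [k_odd|k_even] := boolP (odd k); last first.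
  have -> : (k ^ 2 == 1 %[mod 4 * q]) = false.
    apply/negP => /eqP/(congr1 (modn^~ 2)).
    by rewrite !modn_dvdm ?dvdn_mulr // modn2 oddX /= (negPf k_even).
  by move: q_even; lia.
pose l := k./2; have kE : k = 2 * l + 1 by rewrite /l; lia.
have [k_lt|] := ltnP k (4 * q); last lia.
rewrite sqr_eq1_mod; last lia.
have -> : (k - 1) * (k + 1) = 4 * (l * (l + 1)) by rewrite kE; nia.
have two_ndvd_gcd : ~~ (2 %| gcdn l (l + 1)) by rewrite dvdn_gcd; lia.
have dvdn_q x : x <= 2 * q -> (q %| x) = [|| x == 0, x == q | x == 2 * q].
  move=> x_le; apply/idP/idP => [/dvdnP[c xE]|/or3P[]/eqP->];
    rewrite ?dvdn_mull //.
  have c_le2 : c <= 2 by rewrite xE leq_pmul2r in x_le; lia.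
  by rewrite xE; case: c c_le2 {xE} => [|[|[|c]]] // _; lia.
rewrite dvdn_pmul2l // pfactor_dvdnM // -/q !dvdn_q; lia.
Qed.

End SquareRootsOfOne.

Section SquarefreeNumbers.
Local Open Scope nat_scope.

Definition squarefreeb (n : nat) : bool :=
  all (fun p => logn p n <= 1) (primes n).

Lemma squarefreeP (n : nat) : 0 < n -> reflect (squarefree n) (squarefreeb n).
Proof.
move=> n_gt0; apply: (iffP allP) => [logn_le1 d d2_n|n_sqf p].
  have d_gt0 : 0 < d by have := dvdn_gt0 n_gt0 d2_n; rewrite expn_gt0 orbF.
  apply/eqP; apply: contraT => d_neq1.
  have p_pr : prime (pdiv d) by apply: pdiv_prime; lia.
  have p2_n : pdiv d ^ 2 %| n.
    by rewrite (dvdn_trans _ d2_n) ?dvdn_exp2r ?pdiv_dvd.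
  have p_in : pdiv d \in primes n.
    by rewrite mem_primes p_pr n_gt0 (dvdn_trans _ p2_n) ?dvdn_exp.
  by have := logn_le1 _ p_in; rewrite leqNgt -pfactor_dvdn // p2_n.
rewrite mem_primes => /and3P[p_pr _ _]; rewrite leqNgt -pfactor_dvdn //.
by apply/negP => /n_sqf p1; rewrite p1 in p_pr.
Qed.

End SquarefreeNumbers.

Lemma divisors_frac_perm (n d : nat) : (0 < n)%N -> (d %| n)%N ->
  perm_eq [seq i <- index_iota 1 n.+1 | n %/ gcdn i n == d]%N
    [seq (j * (n %/ d))%N | j <- index_iota 1 d.+1 & coprime j d].
Proof.
move=> n_gt0 /dvdnP[q nE]; rewrite nE in n_gt0 *.
have /andP[q_gt0 d_gt0] : (0 < q)%N && (0 < d)%N by rewrite -muln_gt0.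
rewrite mulnK //; apply: uniq_perm; rewrite ?filter_uniq ?iota_uniq //.
  by rewrite map_inj_uniq ?filter_uniq ?iota_uniq // => x y; nia.
move=> i; rewrite mem_filter mem_index_iota; apply/idP/mapP => [/andP[]|[j]].
  move=> /eqP iE /andP[i_gt0 i_le].
  have gcd_i : gcdn i (q * d) = q.
    by have := divnK (dvdn_gcdr i (q * d)); rewrite iE; nia.
  have /dvdnP[j jE] : (q %| i)%N by rewrite -gcd_i dvdn_gcdl.
  exists j => //; rewrite mem_filter mem_index_iota.
  apply/andP; split; last by nia.
  by move: gcd_i; rewrite jE mulnC -muln_gcdr /coprime; nia.
rewrite mem_filter mem_index_iota => /andP[co /andP[j_gt0 j_le]] ->.
by rewrite (mulnC j) -muln_gcdr (eqP co) muln1 mulKn // eqxx /=; nia.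
Qed.

Lemma sum_reduced_fractions (K : numFieldType) (V : nmodType) (F : K -> V)
    (n : nat) : (0 < n)%N ->
  \sum_(1 <= i < n.+1) F (i%:R / n%:R) =
  divisor_sum (fun d => \sum_(1 <= j < d.+1 | coprime j d) F (j%:R / d%:R)) n.
Proof.
move=> n_gt0.
transitivity (\sum_(1 <= i < n.+1) \sum_(d <- divisors n)
   if (n %/ gcdn i n == d)%N then F (i%:R / n%:R) else 0).
  apply: eq_bigr => i _.
  rewrite (bigD1_seq (n %/ gcdn i n)%N) ?divisors_uniq //=; last first.
    by rewrite -dvdn_divisors // dvdn_div ?dvdn_gcdr.
  by rewrite eqxx big1 ?addr0 // => d; rewrite eq_sym => /negPf->.
rewrite exchange_big; apply: eq_big_seq => d; rewrite -dvdn_divisors // => dn.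
rewrite -big_mkcond -big_filter (perm_big _ (divisors_frac_perm n_gt0 dn)) /=.
rewrite big_map big_filter; apply: eq_bigr => j _; congr F.
move: (n %/ d)%N (divnK dn) => q nE; rewrite -nE muln_gt0 in n_gt0 *.
by rewrite !natrM; field; rewrite !pnatr_eq0 -!lt0n andbC.
Qed.

Lemma sum_periodic (V : nmodType) (F : nat -> V) (m d q : nat) :
    (forall k, F (k + d)%N = F k) ->
  \sum_(m <= k < m + d * q) F k = (\sum_(m <= k < m + d) F k) *+ q.
Proof.
move=> F_periodic; elim: q => [|q IHq]; first by rewrite muln0 addn0 big_geq.
have F_shift k : F (k + d * q)%N = F k.
  elim: q {IHq} => [|q IHq]; first by rewrite muln0 addn0.
  by rewrite mulnS addnCA addnC F_periodic.
rewrite (@big_cat_nat _ _ _ (m + d * q)) /= ?leq_addr ?leq_add2l ?leq_mul //.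
rewrite IHq mulrSr big_addn mulnS addnA addnK.
by under [X in _ + X]eq_bigr do rewrite F_shift.
Qed.

Lemma intr_div_is_int (R : archiNumFieldType) (n : nat) (a : int) : (0 < n)%N ->
  (a%:~R / n%:R : R) \is a Num.int = (n %| a)%Z.
Proof.
move=> n_gt0; have n_neq0 : n%:R != 0 :> R by rewrite pnatr_eq0 -lt0n.
apply/intrP/dvdzP => -[q aE]; exists q; last by rewrite aE intrM mulfK.
by apply/eqP; rewrite -(eqr_int R) intrM -aE divfK.
Qed.

Section AdditiveCharacter.
Variable R : realType.

Definition circle_exp (t : R) : R[i] := cexp ((2 * pi * t) *i).

Lemma circle_expE (t : R) :
  circle_exp t = cos (2 * pi * t) +i* sin (2 * pi * t).
Proof. by rewrite /circle_exp /= expR0 !mul1r. Qed.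

Lemma circle_expD (s t : R) : circle_exp (s + t) = circle_exp s * circle_exp t.
Proof.
rewrite !circle_expE mulrDr cosD sinD.
by apply/eqP; rewrite eq_complex /= eqxx addrC eqxx.
Qed.

Lemma circle_exp0 : circle_exp 0 = 1.
Proof. by rewrite circle_expE mulr0 cos0 sin0. Qed.

Lemma circle_expMn (t : R) (n : nat) : circle_exp (t *+ n) = circle_exp t ^+ n.
Proof.
elim: n => [|n IHn]; first by rewrite circle_exp0.
by rewrite mulrS circle_expD IHn exprS.
Qed.

Lemma circle_exp_int (t : R) : t \is a Num.int -> circle_exp t = 1.
Proof.
have circle_exp_nat n : circle_exp n%:R = 1.
  rewrite circle_expMn circle_expE mulr1 mulr_natl cos2pi sin2pi.
  exact: expr1n.
rewrite intrE => /orP[/natrP[n ->] // | /natrP[n tE]].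
have := circle_expD t (- t).
by rewrite subrr circle_exp0 tE circle_exp_nat mulr1.
Qed.

(* For 0 < u < 1, cos (2 pi u) = 1 - 2 sin^2 (pi u) differs from 1. *)
Lemma circle_exp_eq1 (t : R) : (circle_exp t == 1) = (t \is a Num.int).
Proof.
apply/idP/idP => [|/circle_exp_int/eqP //]; apply: contraTT => t_nint.
pose u := t - (Num.floor t)%:~R.
have /andP[u_gt0 u_lt1] : 0 < u < 1.
  have := floor_itv t; rewrite intrD => /andP[floor_le_t t_lt].
  have : t != (Num.floor t)%:~R.
    by apply: contraNneq t_nint => ->; apply: intr_int.
  by rewrite /u; lra.
have -> : circle_exp t = circle_exp u.
  rewrite -[t in LHS](subrK (Num.floor t)%:~R) circle_expD.
  by rewrite (circle_exp_int (intr_int _ _)) mulr1.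
have sin_gt0 : 0 < sin (pi * u).
  by apply: sin_gt0_pi; rewrite mulr_gt0 ?pi_gt0 //= gtr_pMr ?pi_gt0.
rewrite circle_expE eq_complex negb_and -mulrA mulr_natl cos_mulr2n cos2sin2 /=.
by apply/orP; left; apply/eqP; nra.
Qed.

Lemma sum_circle_exp (n : nat) (a : int) : (0 < n)%N ->
  \sum_(1 <= i < n.+1) circle_exp (i%:R / n%:R * a%:~R) =
  if (n %| a)%Z then n%:R else 0.
Proof.
move=> n_gt0; rewrite -(intr_div_is_int R) //; set t : R := a%:~R / n%:R.
have tn_int : t *+ n \is a Num.int.
  by rewrite -mulr_natr divfK ?intr_int // pnatr_eq0 -lt0n.
have -> : \sum_(1 <= i < n.+1) circle_exp (i%:R / n%:R * a%:~R) =
    circle_exp t * \sum_(i < n) circle_exp t ^+ i.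
  rewrite big_add1 /= big_mkord mulr_sumr; apply: eq_bigr => i _.
  by rewrite -exprS -circle_expMn mulrAC -mulrA mulr_natl.
case: ifPn => [t_int|]; last rewrite -circle_exp_eq1 => t_neq1.
  rewrite circle_exp_int // mul1r.
  by under eq_bigr do rewrite expr1n; rewrite sumr_const card_ord.
have /eqP := subrX1 (circle_exp t) n.
rewrite -circle_expMn circle_exp_int // subrr eq_sym mulf_eq0 subr_eq0.
rewrite (negPf t_neq1) => /eqP->.
exact: mulr0.
Qed.

End AdditiveCharacter.

Section RamanujanSums.
Variable R : realType.

Lemma ramanujan_sumE (n : nat) (a : int) :
  ramanujan_sum R n a =
  \sum_(1 <= j < n.+1 | coprime j n) circle_exp (j%:R / n%:R * a%:~R).
Proof. by apply: eq_bigr => j _; rewrite mulrAC /circle_exp !mulrA. Qed.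

Lemma divisor_sum_ramanujan_sum (n : nat) (a : int) : (0 < n)%N ->
  divisor_sum (fun d => ramanujan_sum R d a) n = if (n %| a)%Z then n%:R else 0.
Proof.
move=> n_gt0; rewrite -sum_circle_exp //.
rewrite (sum_reduced_fractions (fun t => circle_exp (t * a%:~R))) //.
by apply: eq_bigr => d _; apply: ramanujan_sumE.
Qed.

Lemma ramanujan_sum_mod (n : nat) (a b : int) : (0 < n)%N ->
  (a = b %[mod n])%Z -> ramanujan_sum R n a = ramanujan_sum R n b.
Proof.
move=> n_gt0 /eqP; rewrite eqz_mod_dvd => /dvdzP[q abE].
rewrite !ramanujan_sumE -[a](subrK b) abE; apply: eq_bigr => j _.
rewrite intrD mulrDr circle_expD.
rewrite (@circle_exp_int _ (_ * (q * _)%:~R)) ?mul1r //.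
rewrite intrM mulrCA divfK ?pnatr_eq0 -?lt0n // -[j%:R]/(j%:Z%:~R) -intrM.
exact: intr_int.
Qed.

Definition ramanujan_mean (f : {poly int}) (n : nat) : R[i] :=
  n%:R^-1 * \sum_(1 <= k < n.+1) ramanujan_sum R n f.[k%:Z].

Lemma ramanujan_mean_multiple (f : {poly int}) (d n : nat) :
    (0 < n)%N -> (d %| n)%N ->
  ramanujan_mean f d =
  n%:R^-1 * \sum_(1 <= k < n.+1) ramanujan_sum R d f.[k%:Z].
Proof.
move=> n_gt0 /dvdnP[q nE]; rewrite nE in n_gt0 *.
have /andP[q_gt0 d_gt0] : (0 < q)%N && (0 < d)%N by rewrite -muln_gt0.
rewrite [(q * d)%N]mulnC (@sum_periodic _ _ 1) => [|k]; last first.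
  apply: ramanujan_sum_mod => //; apply/eqP; rewrite eqz_mod_dvd.
  apply: dvdz_trans (dvdz_horner_sub _ _ _).
  by rewrite PoszD addrAC subrr add0r.
rewrite natrM -mulr_natr /ramanujan_mean; field.
by rewrite !pnatr_eq0 -!lt0n d_gt0 q_gt0.
Qed.

Lemma divisor_sum_ramanujan_mean (f : {poly int}) (n : nat) : (0 < n)%N ->
  divisor_sum (ramanujan_mean f) n = (num_roots_mod f n)%:R.
Proof.
move=> n_gt0; have n_neq0 : n%:R != 0 :> R[i] by rewrite pnatr_eq0 -lt0n.
pose root_term k : R[i] := if (n %| f.[k%:Z])%Z then n%:R else 0.
transitivity (n%:R^-1 * \sum_(1 <= k < n.+1) root_term k).
  transitivity (\sum_(d <- divisors n)
      n%:R^-1 * \sum_(1 <= k < n.+1) ramanujan_sum R d f.[k%:Z]).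
    apply: eq_big_seq => d; rewrite -dvdn_divisors //.
    exact: ramanujan_mean_multiple.
  rewrite -mulr_sumr exchange_big /=; congr (_ * _); apply: eq_bigr => k _.
  exact: divisor_sum_ramanujan_sum.
have -> : \sum_(1 <= k < n.+1) root_term k = \sum_(0 <= k < n) root_term k.
  rewrite big_nat_recr // [RHS]big_ltn //= addrC; congr (_ + _).
  by rewrite /root_term (@dvdz_horner_modn f n n 0) // modnn mod0n.
rewrite -big_mkcond big_const_seq iter_addr_0 -[_ *+ count _ _]mulr_natr.
by rewrite mulKf // /num_roots_mod /index_iota subn0.
Qed.

Lemma multiplicative_ramanujan_mean (f : {poly int}) :
  multiplicative (ramanujan_mean f).
Proof.
apply: multiplicative_of_divisor_sum.
apply: eq_multiplicative; last first.
  exact: multiplicative_natr (multiplicative_num_roots_mod f).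
by move=> n n_gt0; rewrite divisor_sum_ramanujan_mean.
Qed.

Lemma ramanujan_mean_pfactor (f : {poly int}) (p e : nat) : prime p ->
  ramanujan_mean f (p ^ e.+1) =
  (num_roots_mod f (p ^ e.+1))%:R - (num_roots_mod f (p ^ e))%:R.
Proof.
move=> p_pr; rewrite -!divisor_sum_ramanujan_mean ?expn_gt0 ?prime_gt0 //.
by rewrite divisor_sum_pfactor // addrAC subrr add0r.
Qed.

Lemma ramanujan_mean_sqr_sub1_pow2 (j : nat) :
  ramanujan_mean sqr_sub1 (2 ^ j) = (const_c j)%:R.
Proof.
case: j => [|j]; first exact: (multiplicative_ramanujan_mean _).1.
rewrite ramanujan_mean_pfactor //.
case: j => [|[|[|j]]];
  rewrite ?num_roots_mod_sqr_sub1_pow2 ?num_roots_mod_sqr_sub1E /=.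
- by rewrite subrr.
- by ring.
- by ring.
- by rewrite subrr.
Qed.

Lemma ramanujan_mean_sqr_sub1_odd_pfactor (p e : nat) :
    prime p -> odd p -> (0 < e)%N ->
  ramanujan_mean sqr_sub1 (p ^ e) = (e <= 1)%:R.
Proof.
move=> p_pr p_odd; case: e => // -[|e] _; rewrite ramanujan_mean_pfactor //.
  rewrite num_roots_mod_sqr_sub1_odd_pfactor // num_roots_mod_sqr_sub1E /=.
  by ring.
by rewrite !num_roots_mod_sqr_sub1_odd_pfactor // subrr.
Qed.

Lemma ramanujan_mean_sqr_sub1_odd (m : nat) : odd m ->
  ramanujan_mean sqr_sub1 m = (squarefreeb m)%:R.
Proof.
move=> m_odd; have m_gt0 := odd_gt0 m_odd.
have natr_and : {morph (fun b : bool => b%:R : R[i]) : b c / b && c >-> b * c}.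
  by move=> b c; rewrite -mulnb natrM.
rewrite (multiplicative_prod_primes (multiplicative_ramanujan_mean _)) //.
rewrite /squarefreeb -big_all (big_morph _ natr_and (erefl _)).
apply: eq_big_seq => p; rewrite mem_primes => /and3P[p_pr _ p_m].
apply: ramanujan_mean_sqr_sub1_odd_pfactor => //.
  exact: dvdn_odd p_m m_odd.
by rewrite logn_gt0 mem_primes p_pr m_gt0.
Qed.

End RamanujanSums.

Lemma const_c_neq0 (j : nat) : (const_c j != 0)%N = (j \in [:: 0; 2; 3]%N).
Proof. by case: j => [|[|[|[|j]]]]. Qed.

Theorem corollary5 (R : realType) (n j m : nat) (n_gt0 : (0 < n)%N)
    (n_eq : n = (2 ^ j * m)%N) (m_odd : odd m) :
  let S : R[i] :=
    n%:R^-1 * \sum_(1 <= k < n.+1) ramanujan_sum R n (k%:Z ^+ 2 - 1) in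
  (j \in [:: 0; 2; 3]%N /\ squarefree m -> S = (const_c j)%:R /\ S != 0) /\
  (~ (j \in [:: 0; 2; 3]%N /\ squarefree m) -> S = 0).
Proof.
move=> S; have m_gt0 := odd_gt0 m_odd.
have -> : S = (const_c j)%:R * (squarefreeb m)%:R.
  transitivity (ramanujan_mean R sqr_sub1 n).
    by congr (_ * _); apply: eq_bigr => k _; rewrite !hornerE.
  rewrite n_eq (multiplicative_ramanujan_mean _ _).2 ?expn_gt0 //; last first.
    by rewrite coprimeXl ?coprime2n.
  by rewrite ramanujan_mean_sqr_sub1_pow2 ramanujan_mean_sqr_sub1_odd.
split=> [[j_in /(squarefreeP m_gt0)->]|not_both].
  by rewrite mulr1 pnatr_eq0 const_c_neq0.
apply/eqP; rewrite -natrM pnatr_eq0; apply: contra_notT not_both.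
rewrite muln_eq0 negb_or const_c_neq0 eqb0 negbK.
by case/andP=> j_in /(squarefreeP m_gt0).
Qed.
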